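(* Consider the positive variety with potential $(B_-^3,\Phi_3)$ and the restrictions of the multi-corner minors $M_{\underline\alpha}$, $\underline\alpha\in\Delta^3(n)$, to $B_-^3$. If $\Phi_3^t\le0$ (at a given tropical point), then (at that point) for all small rhombi in $\Delta^3(n)$ with long diagonal $\{\underline\alpha_1,\underline\alpha_3\}$ and short diagonal $\{\underline\alpha_2,\underline\alpha_4\}$, $$M^t_{\underline\alpha_1}+M^t_{\underline\alpha_3}\le M^t_{\underline\alpha_2}+M^t_{\underline\alpha_4}.$$
   Context: **Minors.** $B_-\subset\mathrm{GL}_n(\mathbb C)$ is the group of invertible lower triangular matrices. $[1,k]=\{1,\dots,k\}$ (empty if $k\le0$); $I^{\rm op}=\{n+1-a:a\in I\}$; $I+b=\{a+b:a\in I\}$; $\Delta_{I,J}(g)$ is the minor with rows $I$, columns $J$. For $(g_1,g_2,g_3)\in\mathrm{GL}_n^3$ let $\boldsymbol g=[\,\mathrm{Id}_n\ \ g_1\ \ g_1g_2\ \ g_1g_2g_3\,]$. For $(i,j,k)\in\Delta^3(n):=\{(i,j,k)\in\mathbb Z_{\ge0}^3:i+j+k\le n\}$, $M_{i,j,k}(g_1,g_2,g_3)=\Delta_{[1,n],J}(\boldsymbol g)$ with $J=[1,n-i-j-k]\cup([1,i]+n)\cup([1,j]+2n)\cup([1,k]+3n)$. **Potential.** $\Phi_{\rm BK}(g)=\sum_{i=1}^{n-1}\dfrac{\Delta_{([1,i+1]\setminus\{i\})^{\rm op},[1,i]}(g)+\Delta_{[1,i]^{\rm op},[1,i+1]\setminus\{i\}}(g)}{\Delta_{[1,i]^{\rm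 op},[1,i]}(g)}$, $\Phi_3(g_1,g_2,g_3)=\Phi_{\rm BK}(g_1)+\Phi_{\rm BK}(g_2)+\Phi_{\rm BK}(g_3)-\Phi_{\rm BK}(g_1g_2g_3)$. **Positive chart on $B_-^3$.** For $b\in B_-$, $0\le i\le n-1$, $j\ge1$, $i+j\le n$, put $\Delta_{i,j}(b)=\Delta_{[1,j]^{\rm op},[i+1,i+j]}(b)$, $\Delta_{i,0}=1$, and $\lambda_j^{(n-i)}=\Delta_{i,j}/\Delta_{i,j-1}$. The functions $\lambda^{(l)}_j$, $1\le j\le l\le n$, give a birational isomorphism $B_-\dashrightarrow(\mathbb C^* )^{n(n+1)/2}$ whose inverse is an open embedding $\theta_{\rm GZ}$. On $B_-^3$ use the chart $\theta_{\rm GZ}\times\theta_{\rm GZ}\times\theta_{\rm GZ}$ with coordinates $x_1,\dots,x_d$, $d=3n(n+1)/2$. (An equivalent positive structure is given by factorization parameters of the standard planar network.) A function on $B_-^3$ is positive if it has a subtraction-free expression in these coordinates; $\Phi_3$ and all $M_{\underline\alpha}$ are positive on $B_-^3$. **Tropicalization.** For a positive $f$, $f^t$ is the piecewise linear function of real variables $x_1^t,\dots,x_d^t$ obtained by replacing $(+,\times,/)$ by $(\max,+,-)$ and positive constants by $0$ in a subtraction-free expression of $f$; a Laurent polynomial $\sum_ac_ax^a$ with all $c_a>0$ becomes $\max_a\langle a,x^t\rangle$. A tropical point is a point $(x_1^t,\dots,x_d^t)\in\mathbb R^d$. **Small rhombi.** Identify $\Delta^3(n)$ with $\{x\in\mathbb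 Z_{\ge0}^4:x_0+x_1+x_2+x_3=n\}$ via $x_0=n-x_1-x_2-x_3$. For pairwise distinct $a,b,c\in\{0,1,2,3\}$ and $y\in\mathbb Z^4_{\ge0}$ with $\sum y_i=n-2$, there is a small rhombus with short diagonal $\{y+e_a+e_b,y+e_a+e_c\}$ and long diagonal $\{y+2e_a,y+e_b+e_c\}$; these are all the small rhombi. *)

(* Defs.v *)
From HB Require Import structures.
From mathcomp Require Import all_boot all_order all_algebra.
From mathcomp Require Import reals complex.

Set Implicit Arguments.
Unset Strict Implicit.
Unset Printing Implicit Defensive.

Import Order.TTheory GRing.Theory Num.Theory.

Local Open Scope ring_scope.

(* The row or column label [a], [1 <= a <= m], is the ordinal of value [a.-1] in
   ['I_m].

   The interval of labels {p, ..., q}; it is empty when [q < p].  The shifted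
   interval [1, k] + b is [itv m b.+1 (b + k)]. *)
Definition itv (m p q : nat) : {set 'I_m} := [set a : 'I_m | p <= a.+1 <= q]%N.

(* [rev_ord] is the map a |-> m + 1 - a on labels. *)
Definition opset (m : nat) (I : {set 'I_m}) : {set 'I_m} := [set rev_ord a | a in I].

(* [enum_val] lists a subset of ['I_m] in increasing order.  The minor is
   meaningful only when [#|I| = #|J|]; the value 0 otherwise is never used. *)
Definition minor (F : comNzRingType) (m p : nat)
    (I : {set 'I_m}) (J : {set 'I_p}) (A : 'M[F]_(m, p)) : F :=
  if #|I| =P #|J| is ReflectT eqIJ then
    \det (\matrix_(r < #|I|, s < #|I|) A (enum_val r) (enum_val (cast_ord eqIJ s)))
  else 0.

Section Functions.
Variables (F : fieldType) (n : nat).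

Definition triple : Type := ('I_3 -> 'M[F]_n)%type.

Definition g_ (g : triple) (k : nat) : 'M[F]_n := g (inord k.-1).

Definition gmat (g : triple) : 'M[F]_(n, n + n + n + n) :=
  row_mx (row_mx (row_mx 1%:M (g_ g 1)) (g_ g 1 *m g_ g 2))
         (g_ g 1 *m g_ g 2 *m g_ g 3).

Definition multicorner (i j k : nat) (g : triple) : F :=
  minor (itv n 1 n)
    (itv _ 1 (n - i - j - k) :|: itv _ n.+1 (n + i)
       :|: itv _ (2 * n).+1 (2 * n + j) :|: itv _ (3 * n).+1 (3 * n + k))
    (gmat g).

Definition BK_den (i : nat) (g : 'M[F]_n) : F :=
  minor (opset (itv n 1 i)) (itv n 1 i) g.

Definition Phi_BK (g : 'M[F]_n) : F :=
  \sum_(1 <= i < n)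
    (minor (opset (itv n 1 i.+1 :\: itv n i i)) (itv n 1 i) g
     + minor (opset (itv n 1 i)) (itv n 1 i.+1 :\: itv n i i) g) / BK_den i g.

Definition BK_regular (g : 'M[F]_n) : Prop :=
  forall i : nat, (1 <= i < n)%N -> BK_den i g != 0.

Definition Phi3 (g : triple) : F :=
  Phi_BK (g_ g 1) + Phi_BK (g_ g 2) + Phi_BK (g_ g 3)
  - Phi_BK (g_ g 1 *m g_ g 2 *m g_ g 3).

Definition Phi3_regular (g : triple) : Prop :=
  [/\ BK_regular (g_ g 1), BK_regular (g_ g 2), BK_regular (g_ g 3)
    & BK_regular (g_ g 1 *m g_ g 2 *m g_ g 3)].

(* [is_trig_mx] means lower triangular. *)
Definition Bminus (b : 'M[F]_n) : bool := is_trig_mx b && (b \in unitmx).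

(* For [j = 0] this is an empty determinant, hence equal to 1. *)
Definition GZminor (i j : nat) (b : 'M[F]_n) : F :=
  minor (opset (itv n 1 j)) (itv n i.+1 (i + j)) b.

Definition GZdomain (b : 'M[F]_n) : Prop :=
  forall i j : nat, (i + j <= n)%N -> GZminor i j b != 0.

(* The function lambda_j^(l), 1 <= j <= l <= n. *)
Definition GZlambda (l j : nat) (b : 'M[F]_n) : F :=
  GZminor (n - l) j b / GZminor (n - l) j.-1 b.

End Functions.

(* The pair [(l, j)] of ordinals stands for the coordinate lambda_{j+1}^(l+1). *)
Definition GZindex (n : nat) : Type := {p : 'I_n * 'I_n | (p.2 <= p.1)%N}.

(* The index set of the d = 3 n (n + 1) / 2 coordinates on [B_-^3]. *)
Definition coord_index (n : nat) : Type := ('I_3 * GZindex n)%type.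

Definition coords (F : fieldType) (n : nat) (g : triple F n) (v : coord_index n) : F :=
  GZlambda (sval v.2).1.+1 (sval v.2).2.+1 (g v.1).

Inductive sfexpr (R : realType) (V : Type) : Type :=
| SFvar of V
| SFconst (c : R) of 0 < c
| SFadd of sfexpr R V & sfexpr R V
| SFmul of sfexpr R V & sfexpr R V
| SFdiv of sfexpr R V & sfexpr R V.

Fixpoint sfeval (R : realType) (V : Type) (x : V -> R[i]) (e : sfexpr R V) : R[i] :=
  match e with
  | SFvar v => x v
  | SFconst c _ => real_complex R c
  | SFadd e1 e2 => sfeval x e1 + sfeval x e2
  | SFmul e1 e2 => sfeval x e1 * sfeval x e2
  | SFdiv e1 e2 => sfeval x e1 / sfeval x e2
  end.

(* No denominator of [e] vanishes at [x]. *)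
Fixpoint sfdefined (R : realType) (V : Type) (x : V -> R[i]) (e : sfexpr R V) : bool :=
  match e with
  | SFvar _ | SFconst _ _ => true
  | SFadd e1 e2 | SFmul e1 e2 => sfdefined x e1 && sfdefined x e2
  | SFdiv e1 e2 => [&& sfdefined x e1, sfdefined x e2 & sfeval x e2 != 0]
  end.

Fixpoint sftrop (R : realType) (V : Type) (xt : V -> R) (e : sfexpr R V) : R :=
  match e with
  | SFvar v => xt v
  | SFconst _ _ => 0
  | SFadd e1 e2 => Num.max (sftrop xt e1) (sftrop xt e2)
  | SFmul e1 e2 => sftrop xt e1 + sftrop xt e2
  | SFdiv e1 e2 => sftrop xt e1 - sftrop xt e2
  end.

Definition tropical_point (R : realType) (n : nat) : Type := coord_index n -> R.

(* The rational function [f] on [B_-^3], regular on [dom], equals [e] in the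
   chart.  Both sides are compared where all of them are defined, which is a
   dense open subset of [B_-^3] as soon as [dom] contains one. *)
Definition represents (R : realType) (n : nat)
    (dom : triple R[i] n -> Prop) (f : triple R[i] n -> R[i])
    (e : sfexpr R (coord_index n)) : Prop :=
  forall g : triple R[i] n,
    (forall k, Bminus (g k)) -> (forall k, GZdomain (g k)) ->
    dom g -> sfdefined (coords g) e ->
    f g = sfeval (coords g) e.

(* [f] is positive on [B_-^3], and [ft] is f^t computed from some
   subtraction-free expression of [f]. *)
Definition is_tropicalization (R : realType) (n : nat)
    (dom : triple R[i] n -> Prop) (f : triple R[i] n -> R[i])
    (ft : tropical_point R n -> R) : Prop :=
  exists e : sfexpr R (coord_index n),
    represents dom f e /\ forall xt, ft xt = sftrop xt e.

Definition Delta3 (n : nat) (alpha : nat * nat * nat) : Prop :=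
  (alpha.1.1 + alpha.1.2 + alpha.2 <= n)%N.

(* The identification forgets x_0 = n - x_1 - x_2 - x_3. *)
Definition forget0 (x : 'I_4 -> nat) : nat * nat * nat :=
  (x (inord 1), x (inord 2), x (inord 3)).

Definition small_rhombus (n : nat) (a1 a3 a2 a4 : nat * nat * nat) : Prop :=
  exists (y : 'I_4 -> nat) (a b c : 'I_4),
    [/\ uniq [:: a; b; c], (\sum_i y i + 2 = n)%N &
     [/\ a1 = forget0 (fun i => y i + 2 * (i == a))%N,
         a3 = forget0 (fun i => y i + (i == b) + (i == c))%N,
         a2 = forget0 (fun i => y i + (i == a) + (i == b))%N &
         a4 = forget0 (fun i => y i + (i == a) + (i == c))%N]].

(* Main.v *)
Require Import Defs.
From HB Require Import structures.
From mathcomp Require Import all_boot all_order all_algebra.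
From mathcomp Require Import reals complex.
From mathcomp Require Import zify ring lra.
From mathcomp Require Import boolp sequences exp.

(** Up to sign, M_x is the mixed determinant of four flags F_0, ..., F_3, spanned
    by the columns of 1, g_1, g_1 g_2, g_1 g_2 g_3.  Fix a flag A with vectors
    a_0, a_1, ... and an integer m; for q + r + s = n - m - 1 consider the slope
      [a_0 .. a_(m-1) a_(m+1) B^q C^r E^s] / [a_0 .. a_(m-1) a_m B^q C^r E^s].
    By the three-term Pluecker relation, the difference of two adjacent slopes is
    the ratio M_a1 M_a3 / (M_a2 M_a4) of a small rhombus with a = A and y_a = m.
    All the M_x are positive at points with positive coordinates, so the slopes
    increase from the one with B only to the one with E only, and every rhombus
    ratio is at most the difference of these two.  The sum of these extremal
    differences, over the four flags and over m, is exactly Phi_3; hence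
    M_a1 M_a3 <= Phi_3 M_a2 M_a4.  Evaluating at the point with coordinates
    exp (s * xt), a subtraction-free expression e lies within a constant factor of
    exp (s * e^t), and s -> oo gives the tropical inequality. *)

Set Implicit Arguments.
Unset Strict Implicit.
Unset Printing Implicit Defensive.

Import Order.TTheory GRing.Theory Num.Theory.

Local Open Scope ring_scope.

(** * Wedge products and the Pluecker relation *)

Section Wedge.
Variables (F : fieldType) (n : nat).
Implicit Types (s t : seq 'rV[F]_n) (u v w : 'rV[F]_n).

(** Vectors are kept in lists so that initial pieces of several flags can be concatenated even when
    their total length is only provably [n]. Missing rows read as 0, and rows beyond [n] are
    ignored. *)
Definition wedge s : F := \det (\matrix_(i < n) nth 0 s i).

(** The column [k] consists of the cofactors along row [size s1], which do not see that row; so one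
    [k] serves every [u]. *)
Lemma wedge_linear s1 s2 : (size s1 < n)%N ->
  exists k : 'cV[F]_n, forall u, wedge (s1 ++ u :: s2) = (u *m k) 0 0.
Proof.
move=> hs; pose i0 := Ordinal hs.
exists (\col_j cofactor (\matrix_(i < n) nth 0 (s1 ++ 0 :: s2) i) i0 j) => u.
rewrite /wedge (expand_det_row _ i0) !mxE; apply: eq_bigr => j _; congr (_ * _).
  by rewrite mxE /= nth_cat ltnn subnn.
rewrite mxE /cofactor; congr (_ * \det _); apply/matrixP => a b.
rewrite !mxE /=; congr (_ _ _).
rewrite !nth_cat; case: ltnP => // h.
have := neq_lift i0 a; rewrite -val_eqE /= => hne.
by have -> : (bump (size s1) a - size s1)%N = (bump (size s1) a - size s1).-1.+1 by lia.
Qed.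

Lemma wedge_alt s i j : (i < j < n)%N -> nth 0 s i = nth 0 s j -> wedge s = 0.
Proof.
move=> /andP[hij hj] e; have hi := ltn_trans hij hj.
apply: (@determinant_alternate _ _ _ (Ordinal hi) (Ordinal hj)).
  by rewrite -val_eqE /= neq_ltn hij.
by move=> k; rewrite !mxE /= e.
Qed.

Lemma wedge_adj_eq s1 s2 u : ((size s1).+1 < n)%N -> wedge (s1 ++ u :: u :: s2) = 0.
Proof.
move=> h; apply: (@wedge_alt _ (size s1) (size s1).+1); first by rewrite ltnSn.
by rewrite !nth_cat ltnn subnn ltnNge leqnSn /= subSnn.
Qed.

Lemma wedge_add s1 s2 u v : (size s1 < n)%N ->
  wedge (s1 ++ (u + v) :: s2) = wedge (s1 ++ u :: s2) + wedge (s1 ++ v :: s2).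
Proof. by move=> /wedge_linear-/(_ s2)[k hk]; rewrite !hk mulmxDl mxE. Qed.

Lemma wedge_scale s1 s2 c u : (size s1 < n)%N ->
  wedge (s1 ++ (c *: u) :: s2) = c * wedge (s1 ++ u :: s2).
Proof. by move=> /wedge_linear-/(_ s2)[k hk]; rewrite !hk -scalemxAl mxE. Qed.

Lemma wedge_swap s1 s2 u v : ((size s1).+1 < n)%N ->
  wedge (s1 ++ u :: v :: s2) = - wedge (s1 ++ v :: u :: s2).
Proof.
move=> h; have h' := ltnW h.
(* Polarization: expand the vanishing wedge that has u + v in both adjacent slots. *)
have := wedge_adj_eq s2 (u + v) h.
have E w : s1 ++ w :: (u + v) :: s2 = (s1 ++ [:: w]) ++ (u + v) :: s2.
  by rewrite -catA.
rewrite wedge_add // !E !wedge_add ?size_cat ?addn1 // -!catA /=.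
rewrite !wedge_adj_eq // add0r addr0 => /eqP.
by rewrite addr_eq0 => /eqP ->.
Qed.

Lemma wedge_move s1 t s2 u : (size s1 + size t < n)%N ->
  wedge (s1 ++ t ++ u :: s2) = (-1) ^+ size t * wedge (s1 ++ u :: t ++ s2).
Proof.
elim/last_ind: t s2 => [|t v IH] s2 h; first by rewrite mul1r.
move: h; rewrite size_rcons => h.
have h1 : ((size (s1 ++ t)).+1 < n)%N by rewrite size_cat; lia.
rewrite !cat_rcons catA wedge_swap // -catA IH; last by lia.
by rewrite exprS mulN1r mulNr.
Qed.

(** Each vector of [s] crosses the other n - 1 vectors on its way to the end, and the resulting sign
    is absorbed into that vector. *)
Lemma wedge_rot s t : size (s ++ t) = n ->
  wedge (s ++ t) = wedge (t ++ map (fun u => (-1) ^+ n.-1 *: u) s).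
Proof.
elim: s t => [|u s IH] t h; first by rewrite cats0.
have hn : n.-1 = size (s ++ t) by move: h => /= /(congr1 predn).
have := @wedge_move [::] (s ++ t) [::] u.
rewrite cats0 add0n -hn => hm.
have {hm}/= e := hm ltac:(by move: h => /= h; lia).
rewrite /= -[LHS](signrMK n.-1) -e.
rewrite -catA IH; last by rewrite catA cats1 size_rcons; exact: h.
rewrite -catA -wedge_scale //.
by move: h; rewrite /= size_cat; lia.
Qed.

Lemma wedge_mulmx s (P : 'M_n) : size s = n ->
  wedge (map (mulmx^~ P) s) = wedge s * \det P.
Proof.
move=> h; rewrite -det_mulmx; congr (\det _); apply/row_matrixP => i.
by rewrite row_mul !rowK (nth_map 0) ?h.
Qed.

Lemma wedge_replace s1 s2 z w v : size (s1 ++ z :: w :: s2) = n ->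
  v \in s1 ++ s2 -> wedge (s1 ++ v :: w :: s2) = 0.
Proof.
rewrite size_cat /= => hs; rewrite mem_cat => /orP[/nthP-/(_ 0)[i hi <-]|/nthP-/(_ 0)[i hi <-]].
  apply: (@wedge_alt _ i (size s1)); first by rewrite hi /=; lia.
  by rewrite !nth_cat hi ltnn subnn.
apply: (@wedge_alt _ (size s1) (size s1 + i.+2)); first by apply/andP; split;
  [lia|by rewrite -[X in (_ < X)%N]hs ltn_add2l !ltnS].
rewrite !nth_cat ltnn subnn /= ifN; last by lia.
by rewrite addKn.
Qed.

(** Expand [b] in the basis formed by the rows of the nonsingular wedge. The components along [s1]
    and [s2] repeat a row and die; those along [f] and [f'] give [p] and [q], independently of
    [z]. *)
Lemma wedge_basis s1 s2 f f' b : size (s1 ++ f :: f' :: s2) = n ->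
  wedge (s1 ++ f :: f' :: s2) != 0 ->
  exists p q, forall z, wedge (s1 ++ b :: z :: s2) =
    p * wedge (s1 ++ f :: z :: s2) + q * wedge (s1 ++ f' :: z :: s2).
Proof.
move=> hs; set s := _ ++ _; rewrite /wedge -/s; set P := \matrix__ _ => hP.
have uP : P \in unitmx by rewrite unitmxE unitfE.
have h0 : (size s1 < n)%N by move: hs; rewrite size_cat /=; lia.
have h1 : ((size s1).+1 < n)%N by move: hs; rewrite size_cat /=; lia.
pose k0 := Ordinal h0; pose k1 := Ordinal h1.
exists ((b *m invmx P) 0 k0), ((b *m invmx P) 0 k1) => z; rewrite -!/(wedge _).
have [k hk] := wedge_linear (z :: s2) h0.
have row0 (j : 'I_n) : (P *m k) j 0 = wedge (s1 ++ nth 0 s j :: z :: s2).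
  by rewrite hk /P -(rowK (fun i : 'I_n => nth 0 s i) j) -row_mul [RHS]mxE.
rewrite {1}hk -[b in LHS](mulmxKV uP) -[(_ *m P) *m k]mulmxA mxE.
have k01 : k1 != k0 by rewrite -val_eqE /= neq_ltn ltnSn orbT.
rewrite (bigD1 k0) // (bigD1 k1) //= big1 ?addr0 => [|j /andP[jk0 jk1]].
  rewrite !row0 /= /s !nth_cat ltnn subnn /= ltnNge leqnSn /=.
  by rewrite subSnn.
have hj : (j < size s1 + (size s2).+2)%N.
  by move: (hs); rewrite size_cat /= => e; rewrite [X in (_ < X)%N]e.
rewrite row0 (@wedge_replace _ _ f) ?mulr0 //; first by rewrite -[RHS]hs !size_cat.
rewrite -!val_eqE /= in jk0 jk1.
rewrite mem_cat /s nth_cat; case: ltnP => hji; first by rewrite mem_nth.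
have -> : (j - size s1)%N = (j - size s1 - 2).+2.
  by move: hj hji jk0 jk1; rewrite -!/(size (s1 : seq 'rV_n)); set a := size s1; lia.
rewrite /= [X in _ || X]mem_nth ?orbT //.
move: hj hji jk0 jk1; rewrite -!/(size (s1 : seq 'rV_n)).
by set a := size s1; set d := size s2; lia.
Qed.

(** Setting z = f' and z = f in [wedge_basis] determines [p] and [q] as ratios of wedges; setting z
    = c then gives the relation. *)
Lemma plucker s1 s2 f f' b c : size (s1 ++ f :: f' :: s2) = n ->
  wedge (s1 ++ f :: f' :: s2) != 0 ->
  wedge (s1 ++ f :: f' :: s2) * wedge (s1 ++ b :: c :: s2) =
  wedge (s1 ++ f :: b :: s2) * wedge (s1 ++ f' :: c :: s2)
  - wedge (s1 ++ f :: c :: s2) * wedge (s1 ++ f' :: b :: s2).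
Proof.
move=> hs hff'.
have [p [q hb]] := wedge_basis b hs hff'.
have h1 : ((size s1).+1 < n)%N by move: hs; rewrite size_cat /=; lia.
have hp := hb f'; have hq := hb f.
rewrite (wedge_adj_eq _ _ h1) mulr0 addr0 in hp.
rewrite (wedge_adj_eq _ _ h1) mulr0 add0r in hq.
rewrite wedge_swap // [in RHS]wedge_swap // in hq.
have {hq}-> : wedge (s1 ++ f :: b :: s2) = q * wedge (s1 ++ f :: f' :: s2).
  by apply: oppr_inj; rewrite hq mulrN.
rewrite [X in _ - _ * X]wedge_swap // hp hb.
ring.
Qed.

(** The blocks [X], [Y], [Z] let [b] and [c] be the last vectors taken from two different flags.
    Moving both next to [f] reduces the claim to [plucker]. *)
Lemma slope_diff W f f' X b Y c Z : size (W ++ f :: f' :: X ++ Y ++ Z) = n ->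
  wedge (W ++ f :: f' :: X ++ Y ++ Z) != 0 ->
  wedge (W ++ f :: X ++ b :: Y ++ Z) != 0 ->
  wedge (W ++ f :: X ++ Y ++ c :: Z) != 0 ->
  wedge (W ++ f' :: X ++ Y ++ c :: Z) / wedge (W ++ f :: X ++ Y ++ c :: Z)
  - wedge (W ++ f' :: X ++ b :: Y ++ Z) / wedge (W ++ f :: X ++ b :: Y ++ Z)
  = wedge (W ++ f :: f' :: X ++ Y ++ Z) * wedge (W ++ X ++ b :: Y ++ c :: Z) /
    (wedge (W ++ f :: X ++ b :: Y ++ Z) * wedge (W ++ f :: X ++ Y ++ c :: Z)).
Proof.
move=> hs hff'.
have hsz : (size W + (size X + (size Y + size Z)).+2)%N = n.
  by move: hs; rewrite !size_cat /= !size_cat.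
have E u T : W ++ u :: T = (W ++ [:: u]) ++ T by rewrite -catA.
have mb u : wedge (W ++ u :: X ++ b :: Y ++ Z) =
    (-1) ^+ size X * wedge (W ++ u :: b :: X ++ Y ++ Z).
  by rewrite E wedge_move ?size_cat /= -?catA //; lia.
have mc u : wedge (W ++ u :: X ++ Y ++ c :: Z) =
    (-1) ^+ (size X + size Y) * wedge (W ++ u :: c :: X ++ Y ++ Z).
  by rewrite E [X ++ _]catA wedge_move ?size_cat /= -?catA //; lia.
have mbc : wedge (W ++ X ++ b :: Y ++ c :: Z) =
    (-1) ^+ size Y * wedge (W ++ b :: c :: X ++ Y ++ Z).
  rewrite wedge_move; last by lia.
  rewrite E [X ++ _]catA wedge_move ?size_cat /= -?catA; last by lia.
  by rewrite exprD -mulrA signrMK.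
rewrite !mb !mc mbc => hb hc.
have := plucker b c hs hff'.
move: hb hc; rewrite !mulf_eq0 !negb_or => /andP[_ hb] /andP[_ hc] pl.
have s0 k : (-1) ^+ k != 0 :> F by rewrite signr_eq0.
rewrite exprD; set x := (-1) ^+ size X; set y := (-1) ^+ size Y.
have x0 : x != 0 by exact: s0.
have y0 : y != 0 by exact: s0.
have x2 : x * x = 1 by rewrite /x -expr2 sqrr_sign.
(* The moves leave the sign y in the numerator and x * x * y in the denominator; they cancel because
   x * x = 1. *)
rewrite [RHS](_ : _ = (wedge (W ++ f :: f' :: X ++ Y ++ Z)
    * wedge (W ++ b :: c :: X ++ Y ++ Z)) * y
    / (x * x * y * (wedge (W ++ f :: b :: X ++ Y ++ Z)
    * wedge (W ++ f :: c :: X ++ Y ++ Z)))); last by congr (_ / _); ring.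
by rewrite pl x2; field; rewrite hb hc x0 y0.
Qed.

End Wedge.

(** * Slopes of positive quadruples of flags *)

Section Flags.
Variables (F : fieldType) (n : nat).
Implicit Types A B C E : nat -> 'rV[F]_n.

Definition mixed A B C E p q r s : F :=
  wedge (mkseq A p ++ mkseq B q ++ mkseq C r ++ mkseq E s).

Definition slope A B C E m q r s : F :=
  wedge (mkseq A m ++ A m.+1 :: mkseq B q ++ mkseq C r ++ mkseq E s)
  / mixed A B C E m.+1 q r s.

(* The sign that makes [mixed] invariant under cyclic rotation of the flags. *)
Definition twist A : nat -> 'rV[F]_n := fun k => (-1) ^+ n.-1 *: A k.

Lemma wedge_twist A t k : (k + size t = n)%N ->
  wedge (mkseq A k ++ t) = wedge (t ++ mkseq (twist A) k).
Proof.
move=> h; rewrite wedge_rot ?size_cat ?size_mkseq // /mkseq -map_comp.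
by congr (wedge (_ ++ _)).
Qed.

(** By rotation each of the four flags can be made the first one, so slopes need to be studied for
    the first flag only. *)
Lemma mixed_rot A B C E p q r s : (p + q + r + s = n)%N ->
  mixed A B C E p q r s = mixed B C E (twist A) q r s p.
Proof.
move=> h; rewrite /mixed wedge_twist ?size_cat ?size_mkseq; last by lia.
by rewrite -!catA.
Qed.

End Flags.

Section PositiveFlags.
Variables (F : numFieldType) (n : nat).
Implicit Types A B C E : nat -> 'rV[F]_n.

(** In a [numFieldType] such as R[i] the relation 0 < z also says that z is real, so the estimates
    apply directly over the complex numbers. *)
Definition posflags A B C E : Prop := forall p q r s, (p + q + r + s = n)%N ->
  0 < mixed A B C E p q r s.

Lemma posflags_rot A B C E : posflags A B C E -> posflags B C E (twist A).
Proof. by move=> h p q r s hn; rewrite -mixed_rot; [apply: h|]; lia. Qed.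

Section Slopes.
Variables (A B C E : nat -> 'rV[F]_n) (hpos : posflags A B C E).
Local Notation N := (mixed A B C E).
Local Notation sl := (slope A B C E).

(** This is [slope_diff] with X, Y, Z the initial pieces of B, C, E, and with b and c the next
    vectors of B and of C. *)
Lemma slopeB_C m q r s : (m + q + r + s + 2 = n)%N ->
  sl m q r.+1 s - sl m q.+1 r s =
  N m.+2 q r s * N m q.+1 r.+1 s / (N m.+1 q.+1 r s * N m.+1 q r.+1 s).
Proof.
move=> hn.
have := hpos (p := m.+2) (q := q) (r := r) (s := s).
have := hpos (p := m.+1) (q := q.+1) (r := r) (s := s).
have := hpos (p := m.+1) (q := q) (r := r.+1) (s := s).
rewrite /slope /mixed !mkseqS !cat_rcons.
move=> /(_ ltac:(lia))/lt0r_neq0 h1 /(_ ltac:(lia))/lt0r_neq0 h2.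
move=> /(_ ltac:(lia))/lt0r_neq0 h3.
by rewrite slope_diff // !size_cat /= !size_cat /= !size_mkseq /=; lia.
Qed.

Lemma slopeC_E m q r s : (m + q + r + s + 2 = n)%N ->
  sl m q r s.+1 - sl m q r.+1 s =
  N m.+2 q r s * N m q r.+1 s.+1 / (N m.+1 q r.+1 s * N m.+1 q r s.+1).
Proof.
move=> hn.
have := hpos (p := m.+2) (q := q) (r := r) (s := s).
have := hpos (p := m.+1) (q := q) (r := r.+1) (s := s).
have := hpos (p := m.+1) (q := q) (r := r) (s := s.+1).
rewrite /slope /mixed !mkseqS !cat_rcons.
move=> /(_ ltac:(lia)) + /(_ ltac:(lia)) + /(_ ltac:(lia)).
(* The new vector of [E] comes last, so Z is the empty list in [slope_diff], and X joins the pieces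
   of [B] and [C]. *)
rewrite -[mkseq E s]cats0 !rcons_cat /=.
rewrite ![mkseq B q ++ mkseq C r ++ _]catA.
move=> /lt0r_neq0 h1 /lt0r_neq0 h2 /lt0r_neq0 h3.
by rewrite slope_diff // !size_cat /= !size_cat /= !size_mkseq /=; lia.
Qed.

Lemma slopeB_E m q r s : (m + q + r + s + 2 = n)%N ->
  sl m q r s.+1 - sl m q.+1 r s =
  N m.+2 q r s * N m q.+1 r s.+1 / (N m.+1 q.+1 r s * N m.+1 q r s.+1).
Proof.
move=> hn.
have := hpos (p := m.+2) (q := q) (r := r) (s := s).
have := hpos (p := m.+1) (q := q.+1) (r := r) (s := s).
have := hpos (p := m.+1) (q := q) (r := r) (s := s.+1).
rewrite /slope /mixed !mkseqS !cat_rcons.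
move=> /(_ ltac:(lia)) + /(_ ltac:(lia)) + /(_ ltac:(lia)).
rewrite -[mkseq E s]cats0 !rcons_cat /=.
rewrite ![mkseq C r ++ mkseq E s ++ _]catA.
move=> /lt0r_neq0 h1 /lt0r_neq0 h2 /lt0r_neq0 h3.
by rewrite slope_diff // !size_cat /= !size_cat /= !size_mkseq /=; lia.
Qed.

Let Npos p q r s : (p + q + r + s = n)%N -> 0 < N p q r s.
Proof. exact: hpos. Qed.

(** Hand over k vectors from B to C one at a time; each increment is a rhombus ratio, hence
    nonnegative. *)
Lemma slope_leBC m q r s k : (m + q + r + s + k + 1 = n)%N ->
  sl m (q + k) r s <= sl m q (r + k) s.
Proof.
elim: k q r => [|k IH] q r hn; first by rewrite !addn0.
rewrite addnS; apply: le_trans (_ : sl m (q + k) r.+1 s <= _).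
  rewrite -subr_ge0 slopeB_C; last by lia.
  by rewrite divr_ge0 ?mulr_ge0 // ltW // Npos; lia.
by rewrite -addSnnS; apply: IH; lia.
Qed.

Lemma slope_leCE m q r s k : (m + q + r + s + k + 1 = n)%N ->
  sl m q (r + k) s <= sl m q r (s + k).
Proof.
elim: k r s => [|k IH] r s hn; first by rewrite !addn0.
rewrite addnS; apply: le_trans (_ : sl m q (r + k) s.+1 <= _).
  rewrite -subr_ge0 slopeC_E; last by lia.
  by rewrite divr_ge0 ?mulr_ge0 // ltW // Npos; lia.
by rewrite -addSnnS; apply: IH; lia.
Qed.

(** The largest slope minus the smallest one, by [slope_ub] and [slope_lb]. *)
Definition spread m : F := sl m 0 0 (n - m.+1) - sl m (n - m.+1) 0 0.

Lemma slope_lb m q r s : (m + q + r + s + 1 = n)%N ->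
  sl m (n - m.+1) 0 0 <= sl m q r s.
Proof.
(* Starting from B alone, r + s vectors pass to C, and then s of these pass on to E. *)
move=> hn; have -> : (n - m.+1 = q + (r + s))%N by lia.
apply: le_trans (slope_leBC _) _; first by lia.
by rewrite add0n; apply: slope_leCE; lia.
Qed.

Lemma slope_ub m q r s : (m + q + r + s + 1 = n)%N ->
  sl m q r s <= sl m 0 0 (n - m.+1).
Proof.
move=> hn; have -> : (n - m.+1 = s + (r + q))%N by lia.
rewrite -[q in sl _ q]add0n.
apply: le_trans (slope_leBC _) _; first by lia.
by rewrite -[X in sl m 0 X s <= _]add0n; apply: slope_leCE; lia.
Qed.

Lemma spread_ge0 m : (m < n)%N -> 0 <= spread m.
Proof. by move=> h; rewrite subr_ge0; apply: slope_lb; lia. Qed.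

Lemma rhombus_le_spread m q r s : (m + q + r + s + 2 = n)%N ->
  [/\ N m.+2 q r s * N m q.+1 r.+1 s / (N m.+1 q.+1 r s * N m.+1 q r.+1 s)
        <= spread m,
      N m.+2 q r s * N m q.+1 r s.+1 / (N m.+1 q.+1 r s * N m.+1 q r s.+1)
        <= spread m &
      N m.+2 q r s * N m q r.+1 s.+1 / (N m.+1 q r.+1 s * N m.+1 q r s.+1)
        <= spread m].
Proof.
move=> hn; split; [rewrite -slopeB_C // | rewrite -slopeB_E // | rewrite -slopeC_E //];
  by apply: lerB; [apply: slope_ub | apply: slope_lb]; lia.
Qed.

End Slopes.
End PositiveFlags.

(** * Minors as wedge products of columns *)

Section NatDet.
Variable F : comNzRingType.
Implicit Types f g : nat -> nat -> F.

(* Determinants and entries are indexed by natural numbers, so that sizes that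
   are only provably equal can be rewritten freely. *)
Definition ndet k f : F := \det (\matrix_(r < k, s < k) f r s).

Lemma eq_ndet k f g : (forall r s, r < k -> s < k -> f r s = g r s)%N ->
  ndet k f = ndet k g.
Proof.
by move=> h; congr (\det _); apply/matrixP => r s; rewrite !mxE; apply: h.
Qed.

Lemma ndet_tr k f : ndet k f = ndet k (fun r s => f s r).
Proof. by rewrite /ndet -det_tr; congr (\det _); apply/matrixP => r s; rewrite !mxE. Qed.

Lemma ndet_strip k l f :
  (forall r s, r < k -> s < k + l -> f r s = (r == s)%:R)%N ->
  ndet (k + l) f = ndet l (fun r s => f (k + r)%N (k + s)%N).
Proof.
move=> h; rewrite /ndet (_ : \matrix_(r < k + l, s < k + l) f r s =
  block_mx 1%:M 0 (\matrix_(r, s) f (rshift k r) (lshift l s))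
    (\matrix_(r, s) f (rshift k r) (rshift k s))); last first.
  apply/matrixP => r s; rewrite -[r]splitK -[s]splitK.
  case: (split r) => r'; case: (split s) => s' /=; rewrite [LHS]mxE.
  - by rewrite block_mxEul mxE h //=; have := ltn_ord s'; lia.
  - rewrite block_mxEur mxE h //=; last by have := ltn_ord s'; lia.
    by have := ltn_ord r'; case: eqP => //; lia.
  - by rewrite block_mxEdl mxE.
  - by rewrite block_mxEdr mxE.
by rewrite det_lblock det1 mul1r.
Qed.

(** The first row is the unit vector at position 1, so one cofactor survives, and its sign is -1.
    This is the source of the minus sign in [wedge_BK_first]. *)
Lemma ndet_skip i f : (0 < i)%N ->
  (forall s, s <= i -> f 0 s = (s == 1)%:R)%N ->
  ndet i.+1 f = - ndet i (fun r s => f r.+1 (bump 1 s)).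
Proof.
case: i => // i _ h; rewrite /ndet (expand_det_row _ ord0).
rewrite (bigD1 (lift ord0 ord0)) //= big1 ?addr0 => [|s hs].
  rewrite mxE h // mul1r /cofactor /= expr1 mulN1r; congr (- \det _).
  by apply/matrixP => r s; rewrite !mxE.
rewrite mxE h; last by rewrite -ltnS.
by move: hs; rewrite -val_eqE /= /bump /= => /negbTE ->; rewrite mul0r.
Qed.

(** A determinant is affine in its upper left entry: [y] gathers the remaining terms of the
    expansion along the first row. *)
Lemma ndet_corner k f : exists y, forall x,
  ndet k.+1 (fun r s => if (r == 0)%N && (s == 0)%N then x else f r s)
  = x * ndet k (fun r s => f r.+1 s.+1) + y.
Proof.
exists (\sum_(j < k) f 0%N j.+1 *
  cofactor (\matrix_(r < k.+1, s < k.+1) f r s) ord0 (lift ord0 j)) => x.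
rewrite /ndet (expand_det_row _ ord0) big_ord_recl mxE /=; congr (_ + _).
  rewrite /cofactor expr0 mul1r; congr (_ * \det _).
  by apply/matrixP => r s; rewrite !mxE.
apply: eq_bigr => j _; rewrite mxE /=; congr (_ * (_ * \det _)).
by apply/matrixP => r s; rewrite !mxE.
Qed.

Definition entry m p (A : 'M[F]_(m, p)) (a b : nat) : F :=
  if insub a is Some i then if insub b is Some j then A i j else 0 else 0.

Lemma entryE m p (A : 'M[F]_(m, p)) (i : 'I_m) (j : 'I_p) : entry A i j = A i j.
Proof. by rewrite /entry !valK. Qed.

Definition labels m (I : {set 'I_m}) : seq nat := map val (enum I).

(** A strictly increasing list is determined by its set of members. Labels are zero-based here. *)
Lemma labelsE m (I : {set 'I_m}) s : sorted ltn s -> all (fun a => a < m)%N s ->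
  (forall a : 'I_m, (a \in I) = (val a \in s)) -> labels I = s.
Proof.
move=> hs hm h; apply: (irr_sorted_eq ltn_trans ltnn) => // [|a].
  rewrite /labels sorted_map /enum_mem.
  apply: (sorted_filter (leT := relpre val ltn)); first by move=> a b c; apply: ltn_trans.
  by rewrite -enumT -sorted_map val_enum_ord iota_ltn_sorted.
apply/mapP/idP => [[b hb ->]|ha]; first by rewrite -h -(mem_enum I).
have ham : (a < m)%N by apply: (allP hm).
by exists (Ordinal ham) => //; rewrite mem_enum h.
Qed.

Lemma minorE m p (I : {set 'I_m}) (J : {set 'I_p}) (A : 'M[F]_(m, p)) sI sJ :
  labels I = sI -> labels J = sJ -> size sI = size sJ ->
  minor I J A = ndet (size sI) (fun r s => entry A (nth 0%N sI r) (nth 0%N sJ s)).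
Proof.
move=> <- <-; rewrite !size_map -!cardE => hc; rewrite /minor.
case: eqP => // e; congr (\det _); apply/matrixP => r s; rewrite !mxE.
have n1 (q : nat) (T : {set 'I_q}) (t : 'I_#|T|) : nth 0%N (labels T) t = enum_val t.
  by rewrite (nth_map (enum_val t)) -?cardE // -enum_val_nth.
by rewrite n1 -(entryE A) -(n1 p J).
Qed.

End NatDet.

Lemma sorted_iota_cat a b s : sorted ltn s -> all (fun x => a + b <= x)%N s ->
  sorted ltn (iota a b ++ s).
Proof.
elim: b a => //= b IH a hs ha; rewrite (path_sortedE ltn_trans); apply/andP; split.
  rewrite all_cat; apply/andP; split; apply/allP => x.
    by rewrite mem_iota => /andP[].
  by move=> /(allP ha); lia.
by apply: IH => //; rewrite addSnnS.
Qed.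

Section Labels.
Variable n : nat.

Lemma mem_opset (I : {set 'I_n}) a : (a \in opset I) = (rev_ord a \in I).
Proof.
by rewrite -{1}[a]rev_ordK mem_imset //; apply: rev_ord_inj.
Qed.

Lemma all_iota_lt m a b : (a + b <= m)%N -> all (fun x => x < m)%N (iota a b).
Proof. by move=> h; apply/allP => x; rewrite mem_iota; lia. Qed.

Lemma labels_itv p q : (0 < p)%N -> (q <= n)%N ->
  labels (itv n p q) = iota p.-1 (q.+1 - p).
Proof.
move=> hp hq; apply: labelsE; [exact: iota_ltn_sorted| |].
  by apply/allP => x; rewrite mem_iota; lia.
by move=> a; rewrite inE mem_iota /=; lia.
Qed.

Lemma labels_opset i : (i <= n)%N -> labels (opset (itv n 1 i)) = iota (n - i) i.
Proof.
move=> hi; apply: labelsE; [exact: iota_ltn_sorted|apply: all_iota_lt; lia|].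
by move=> a; rewrite mem_opset inE /= mem_iota /=; have := ltn_ord a; lia.
Qed.

Lemma labels_skip i : (0 < i < n)%N ->
  labels (itv n 1 i.+1 :\: itv n i i) = iota 0 i.-1 ++ [:: i].
Proof.
move=> hi; apply: labelsE; [apply: sorted_iota_cat => //=; lia| |].
  by rewrite all_cat all_iota_lt /=; lia.
by move=> a; rewrite !inE mem_cat mem_iota inE /=; lia.
Qed.

Lemma labels_op_skip i : (0 < i < n)%N ->
  labels (opset (itv n 1 i.+1 :\: itv n i i)) = (n - i.+1)%N :: iota (n - i).+1 i.-1.
Proof.
move=> hi; apply: labelsE.
- rewrite -[_ :: _]/(iota (n - i.+1) 1 ++ _); apply: sorted_iota_cat.
    exact: iota_ltn_sorted.
  by apply/allP => x; rewrite mem_iota; lia.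
- by apply/andP; split; [|apply: all_iota_lt]; lia.
- by move=> a; rewrite mem_opset !inE /= mem_iota /=; have := ltn_ord a; lia.
Qed.

End Labels.

(** * Flags of columns and the minors of the potential *)

Section Columns.
Variables (F : fieldType) (n : nat).
Implicit Types (g h : 'M[F]_n).

(** Columns are stored as row vectors to fit [wedge], and indexed by all naturals (0 out of range)
    so that a flag is a function on [nat]. *)
Definition vcol p (A : 'M[F]_(n, p)) (j : nat) : 'rV[F]_n := \row_i entry A i j.

Lemma entry_vcol p (A : 'M[F]_(n, p)) a c : (c < n)%N ->
  entry (vcol A a) 0 c = entry A c a.
Proof.
move=> hc; have [i ->] : exists i : 'I_n, c = i by exists (Ordinal hc).
by rewrite -[0%N]/(val (ord0 : 'I_1)) entryE mxE.
Qed.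

Lemma wedge_ndet (s : seq 'rV[F]_n) :
  wedge s = ndet n (fun i j => entry (nth 0 s i) 0 j).
Proof.
congr (\det _); apply/matrixP => i j; rewrite !mxE.
by rewrite -[0%N]/(val (ord0 : 'I_1)) entryE.
Qed.

Lemma vcol_row_mx_l p q (A : 'M[F]_(n, p)) (B : 'M[F]_(n, q)) j : (j < p)%N ->
  vcol (row_mx A B) j = vcol A j.
Proof.
move=> hj; apply/rowP => i; rewrite !mxE.
have [k ->] : exists k : 'I_p, j = k by exists (Ordinal hj).
by have := entryE (row_mx A B) i (lshift q k); rewrite /= row_mxEl entryE.
Qed.

Lemma vcol_row_mx_r p q (A : 'M[F]_(n, p)) (B : 'M[F]_(n, q)) j : (j < q)%N ->
  vcol (row_mx A B) (p + j) = vcol B j.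
Proof.
move=> hj; apply/rowP => i; rewrite !mxE.
have [k ->] : exists k : 'I_q, j = k by exists (Ordinal hj).
by have := entryE (row_mx A B) i (rshift p k); rewrite /= row_mxEr entryE.
Qed.

Lemma vcol_mulmx g h j : vcol (h *m g) j = vcol g j *m h^T.
Proof.
apply/rowP => i; rewrite !mxE; case: (ltnP j n) => hj.
  have [q ->] : exists q : 'I_n, j = q by exists (Ordinal hj).
  by rewrite entryE mxE; apply: eq_bigr => k _; rewrite !mxE entryE mulrC.
rewrite /entry valK insubF ?big1 // => [k _|]; last by rewrite ltnNge hj.
by rewrite mxE /entry valK insubF ?mul0r // ltnNge hj.
Qed.

Lemma vcol_mul1 h j : vcol h j = vcol 1%:M j *m h^T.
Proof. by rewrite -vcol_mulmx mulmx1. Qed.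

Lemma entry1 a c : (a < n)%N -> (c < n)%N -> entry (1%:M : 'M[F]_n) c a = (a == c)%:R.
Proof.
move=> ha hc; have [i ->] : exists i : 'I_n, a = i by exists (Ordinal ha).
have [j ->] : exists j : 'I_n, c = j by exists (Ordinal hc).
by rewrite entryE mxE eq_sym.
Qed.

Local Notation e := (vcol 1%:M).

(** The leading unit vectors remove the first k coordinates and leave a minor in the bottom rows. *)
Lemma wedge_e k (L : seq nat) g : (k + size L = n)%N ->
  wedge (mkseq e k ++ map (vcol g) L) =
  ndet (size L) (fun r s => entry g (k + r)%N (nth 0%N L s)).
Proof.
move=> hn; rewrite wedge_ndet -{1}hn ndet_strip => [|r s hr hs].
  rewrite ndet_tr; apply: eq_ndet => r s hr hs.
  rewrite nth_cat size_mkseq ltnNge leq_addr /= addKn (nth_map 0%N) //.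
  by rewrite entry_vcol //; lia.
rewrite nth_cat size_mkseq hr nth_mkseq // entry_vcol ?entry1 //; lia.
Qed.

(** Omitting unit vector m in favour of m + 1 leaves the rows m, m + 2, m + 3, ..., which [bump 1]
    enumerates. *)
Lemma wedge_e_skip m i g : (0 < i)%N -> (m + i.+1 = n)%N ->
  wedge (mkseq e m ++ e m.+1 :: mkseq (vcol g) i) =
  - ndet i (fun r s => entry g (m + bump 1 r)%N s).
Proof.
move=> hi hn; rewrite wedge_ndet -{1}hn ndet_strip => [|r s hr hs]; last first.
  rewrite nth_cat size_mkseq hr nth_mkseq // entry_vcol ?entry1 //; lia.
rewrite ndet_skip //= => [|s hs].
  congr (- _); rewrite ndet_tr; apply: eq_ndet => r s hr hs.
  rewrite nth_cat size_mkseq ltnNge leq_addr /= addKn /= nth_mkseq //.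
  by rewrite entry_vcol // /bump; lia.
rewrite addn0 nth_cat size_mkseq ltnn subnn /= entry_vcol ?entry1; try lia.
by congr (_%:R); apply/eqP/eqP; lia.
Qed.

Definition BK_first (i : nat) g : F :=
  minor (opset (itv n 1 i.+1 :\: itv n i i)) (itv n 1 i) g / BK_den i g.

Definition BK_second (i : nat) g : F :=
  minor (opset (itv n 1 i)) (itv n 1 i.+1 :\: itv n i i) g / BK_den i g.

Lemma Phi_BKE g : Phi_BK g = \sum_(1 <= i < n) (BK_first i g + BK_second i g).
Proof. by apply: eq_bigr => i _; rewrite mulrDl. Qed.

(** A common left factor [h] acts on all columns and contributes its determinant, so the flags of
    [h] and [h *m g] compare like those of 1 and [g]. *)
Lemma wedge_BK_den h g k i : (k + i = n)%N ->
  wedge (mkseq (vcol h) k ++ mkseq (vcol (h *m g)) i) = BK_den i g * \det h.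
Proof.
move=> hn; rewrite -[\det h]det_tr.
have -> : BK_den i g = wedge (mkseq e k ++ mkseq (vcol g) i).
  rewrite wedge_e ?size_iota // /BK_den.
  rewrite (minorE _ (labels_opset _) (labels_itv _ _)) ?size_iota; try lia.
  apply: eq_ndet => r s hr hs; rewrite subn1 /= !nth_iota //; try lia.
  by congr (entry _ _ _); lia.
rewrite -wedge_mulmx ?size_cat ?size_mkseq // map_cat /mkseq -!map_comp.
congr (wedge (_ ++ _)); apply: eq_map => j /=; first by rewrite vcol_mul1.
by rewrite vcol_mulmx.
Qed.

Lemma wedge_BK_first h g m : h \in unitmx -> (m.+1 < n)%N ->
  wedge (mkseq (vcol h) m ++ vcol h m.+1 :: mkseq (vcol (h *m g)) (n - m.+1))
  / wedge (mkseq (vcol h) m.+1 ++ mkseq (vcol (h *m g)) (n - m.+1))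
  = - BK_first (n - m.+1) g.
Proof.
move=> uh hm; have h0 : \det h != 0 by rewrite -unitfE -unitmxE.
rewrite wedge_BK_den; last by lia.
set i := (n - m.+1)%N.
(* The factor det h also comes out of the numerator, and cancels in the quotient. *)
have -> : wedge (mkseq (vcol h) m ++ vcol h m.+1 :: mkseq (vcol (h *m g)) i)
  = wedge (mkseq e m ++ e m.+1 :: mkseq (vcol g) i) * \det h.
  rewrite -[\det h]det_tr -wedge_mulmx; last first.
    by rewrite size_cat /= !size_mkseq /i; lia.
  rewrite map_cat /= /mkseq -!map_comp -vcol_mul1.
  congr (wedge (_ ++ _ :: _)); apply: eq_map => j /=; first by rewrite vcol_mul1.
  by rewrite vcol_mulmx.
rewrite -mulf_div divff // mulr1 /BK_first -mulNr; congr (_ / _).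
rewrite wedge_e_skip; try (rewrite /i; lia).
rewrite (minorE _ (labels_op_skip _) (labels_itv _ _)) /= ?size_iota; try (rewrite /i; lia).
have -> : i.-1.+1 = i by rewrite /i; lia.
congr (- _); apply: eq_ndet => r s hr hs; rewrite nth_iota; last by lia.
congr (entry _ _ _); case: r hr => [|r] hr /=; first by rewrite /bump /i; lia.
by rewrite nth_iota /bump /i; lia.
Qed.

Lemma wedge_BK_second h g m : h \in unitmx -> (m.+1 < n)%N ->
  wedge (mkseq (vcol h) (n - m.+1) ++ mkseq (vcol (h *m g)) m ++ [:: vcol (h *m g) m.+1])
  / wedge (mkseq (vcol h) (n - m.+1) ++ mkseq (vcol (h *m g)) m.+1)
  = BK_second m.+1 g.
Proof.
move=> uh hm; have h0 : \det h != 0 by rewrite -unitfE -unitmxE.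
rewrite wedge_BK_den; last by lia.
set i := (n - m.+1)%N.
have -> : wedge (mkseq (vcol h) i ++ mkseq (vcol (h *m g)) m ++ [:: vcol (h *m g) m.+1])
  = wedge (mkseq e i ++ map (vcol g) (iota 0 m ++ [:: m.+1])) * \det h.
  rewrite -[\det h]det_tr -wedge_mulmx; last first.
    by rewrite size_cat size_mkseq size_map size_cat size_iota /= /i; lia.
  rewrite !map_cat /= /mkseq -!map_comp vcol_mulmx.
  congr (wedge (_ ++ _ ++ _)); apply: eq_map => j /=; first by rewrite vcol_mul1.
  by rewrite vcol_mulmx.
rewrite -mulf_div divff // mulr1 /BK_second; congr (_ / _).
rewrite wedge_e; last by rewrite size_cat size_iota /= /i; lia.
rewrite (minorE _ (labels_opset _) (labels_skip _)) ?size_cat ?size_iota; try (rewrite /i /=; lia).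
rewrite addn1; apply: eq_ndet => r s hr hs.
by rewrite nth_iota.
Qed.

Definition flag0 (g : triple F n) := vcol (1%:M : 'M[F]_n).
Definition flag1 (g : triple F n) := vcol (g_ g 1).
Definition flag2 (g : triple F n) := vcol (g_ g 1 *m g_ g 2).
Definition flag3 (g : triple F n) := vcol (g_ g 1 *m g_ g 2 *m g_ g 3).

(** The sorted column set consists of four runs, one in each block of [gmat]; they list the flags in
    the order used by [mixed], so no sign appears. *)
Lemma multicornerE i j k (g : triple F n) : (i + j + k <= n)%N ->
  multicorner i j k g =
  mixed (flag0 g) (flag1 g) (flag2 g) (flag3 g) (n - i - j - k) i j k.
Proof.
move=> hn; set x := (n - i - j - k)%N; rewrite /multicorner -/x.
have hx : (x + i + j + k = n)%N by rewrite /x; lia.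
have hI : labels (itv n 1 n) = iota 0 n by rewrite labels_itv //= subn1.
set J := _ :|: _ :|: _ :|: _.
have hJ : labels J = iota 0 x ++ iota n i ++ iota (2 * n) j ++ iota (3 * n) k.
  apply: labelsE.
  - do 3 (apply: sorted_iota_cat; last by apply/allP => a; rewrite ?mem_cat ?mem_iota; lia).
    exact: iota_ltn_sorted.
  - by apply/allP => a; rewrite !mem_cat !mem_iota; lia.
  - by move=> a; rewrite !inE !mem_cat !mem_iota /=; lia.
rewrite (minorE _ hI hJ); last by rewrite !size_cat !size_iota; lia.
rewrite size_iota /mixed wedge_ndet ndet_tr; apply: eq_ndet => r s hr hs.
rewrite nth_iota // -(entry_vcol (gmat g)) //.
rewrite -(nth_map _ 0) ?size_cat ?size_iota; last by lia.
congr (entry (nth _ _ _) _ _); rewrite !map_cat /mkseq.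
rewrite -[X in iota X i]addn0 -[X in iota X j]addn0 -[X in iota X k]addn0.
rewrite !iotaDl -!map_comp.
congr (_ ++ _ ++ _ ++ _); apply/eq_in_map => a; rewrite mem_iota => /= ha;
  rewrite /gmat.
- by rewrite !vcol_row_mx_l //; lia.
- by rewrite 2?vcol_row_mx_l ?vcol_row_mx_r //; lia.
- by rewrite vcol_row_mx_l ?mul2n -?addnn ?vcol_row_mx_r //; lia.
- by have -> : (3 * n = n + n + n)%N by [lia]; rewrite vcol_row_mx_r //; lia.
Qed.

End Columns.

(** * Surjectivity of the chart *)

Section GZInverse.
Variables (F : fieldType) (n : nat).

Lemma GZminorE i j (b : 'M[F]_n) : (i + j <= n)%N ->
  GZminor i j b = ndet j (fun r s => entry b (n - j + r)%N (i + s)%N).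
Proof.
move=> h; rewrite /GZminor (minorE _ (labels_opset _) (labels_itv _ _)) ?size_iota; try lia.
apply: eq_ndet => r s hr hs; rewrite !nth_iota //; lia.
Qed.

(* The entries are found one at a time, rows from the bottom up and each row from
   right to left: the new entry is the upper left corner of its minor, whose
   complementary minor has been prescribed before and is nonzero. *)
Lemma solid_minors_surj (D : nat -> nat -> F) :
  (forall i, D i 0%N = 1) -> (forall i j, (i + j <= n)%N -> D i j != 0) ->
  exists f : nat -> nat -> F, (forall r c, (r < c)%N -> f r c = 0) /\
    forall i j, (i + j <= n)%N ->
      ndet j (fun r s => f (n - j + r)%N (i + s)%N) = D i j.
Proof.
move=> D0 Dn0.
(* Outer induction on the size of the minors already prescribed. *)
suff H j0 : exists f : nat -> nat -> F, (forall r c, (r < c)%N -> f r c = 0) /\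
    forall i j, (i + j <= n)%N -> (j <= j0)%N ->
      ndet j (fun r s => f (n - j + r)%N (i + s)%N) = D i j.
  have [f [f0 hf]] := H n; exists f; split=> // i j hij; apply: hf => //; lia.
elim: j0 => [|j0 [f [f0 hf]]].
  exists (fun _ _ => 0); split=> // i [|j] // _ _.
  by rewrite /ndet det_mx00.
(* Inner induction: among the minors of size j0 + 1, those with first column at least n - k are
   already prescribed. *)
suff H k : exists f : nat -> nat -> F, (forall r c, (r < c)%N -> f r c = 0) /\
    forall i j, (i + j <= n)%N -> (j <= j0)%N || (j == j0.+1) && (n - k <= i)%N ->
      ndet j (fun r s => f (n - j + r)%N (i + s)%N) = D i j.
  have [f' [f0' hf']] := H n; exists f'; split=> // i j hij hj; apply: hf' => //; lia.
elim: k => [|k {f f0 hf} [f [f0 hf]]].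
  by exists f; split=> // i j hij hj; apply: hf => //; lia.
have [hk|hk] := leqP (n - k.+1 + j0.+1) n; last first.
  by exists f; split=> // i j hij hj; apply: hf => //; lia.
(* Truncated subtraction: equality means n <= k, when no column is left to treat. *)
have [hk0|hk0] := eqVneq (n - k)%N (n - k.+1)%N.
  by exists f; split=> // i j hij hj; apply: hf => //; lia.
set i0 := (n - k.+1)%N in hk hk0 *.
have [y hy] := ndet_corner j0 (fun r s => f (n - j0.+1 + r)%N (i0 + s)%N).
(* Solution of the affine equation of [ndet_corner], whose leading coefficient is the prescribed
   nonzero minor D i0.+1 j0. *)
pose x := (D i0 j0.+1 - y) / D i0.+1 j0.
pose f' r c := if (r == n - j0.+1)%N && (c == i0) then x else f r c.
exists f'; split=> [r c hrc|i j hij hj].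
  by rewrite /f' ifN ?f0 //; apply/negP => /andP[/eqP ? /eqP ?]; lia.
have [/andP[/eqP-> /eqP->]|hne] := boolP ((j == j0.+1) && (i == i0)).
  transitivity (x * ndet j0 (fun r s => f (n - j0.+1 + r.+1)%N (i0 + s.+1)%N) + y).
    rewrite -hy; apply: eq_ndet => r s hr hs; rewrite /f'.
    by congr (if _ then _ else _); apply/andP/andP => -[/eqP ? /eqP ?]; split; lia.
  rewrite (@eq_ndet _ _ _ (fun r s => f (n - j0 + r)%N (i0.+1 + s)%N)).
    by rewrite hf; [rewrite /x divfK ?subrK // Dn0|..]; lia.
  by move=> r s hr hs; congr f; lia.
(* All other minors treated so far lie strictly below or strictly to the right of the new entry. *)
rewrite -hf //; last by lia.
apply: eq_ndet => r s hr hs; rewrite /f' ifN //.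
by apply/negP => /andP[/eqP ? /eqP ?]; lia.
Qed.

Lemma GZchart_surj (x : GZindex n -> F) : (forall v, x v != 0) ->
  exists b : 'M[F]_n, [/\ Bminus b, GZdomain b &
    forall v : GZindex n, GZlambda (sval v).1.+1 (sval v).2.+1 b = x v].
Proof.
move=> x0.
(* [X l t] is the coordinate with upper index l and lower index t + 1, extended by the nonzero value
   1 outside the index set. *)
pose X l t : F :=
  if insub l.-1 : option 'I_n is Some a then
    if insub t : option 'I_n is Some b then
      if insub (a, b) : option {p : 'I_n * 'I_n | (p.2 <= p.1)%N} is Some v
      then x v else 1
    else 1
  else 1.
have X0 l t : X l t != 0.
  by rewrite /X; do 3 (case: insub => [?|]; rewrite ?oner_neq0 //).
have XE (v : GZindex n) : X (sval v).1.+1 (sval v).2 = x v.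
  case: v => -[a c] hac; rewrite /X /= !valK insubT.
  by congr (x _); apply: val_inj.
(* The coordinates are ratios of consecutive solid minors, so the minors are their telescoping
   products. *)
pose D i j := \prod_(t < j) X (n - i)%N t.
have Dn0 i j : D i j != 0 by apply/prodf_neq0 => t _.
have [|f [f0 hf]] := @solid_minors_surj D _ (fun i j _ => Dn0 i j).
  by move=> i; rewrite /D big_ord0.
pose b : 'M[F]_n := \matrix_(i, j) f i j.
have hb i j : (i + j <= n)%N -> GZminor i j b = D i j.
  move=> hij; rewrite GZminorE // -hf //; apply: eq_ndet => r s hr hs.
  have h1 : (n - j + r < n)%N by lia.
  have h2 : (i + s < n)%N by lia.
  by have := entryE b (Ordinal h1) (Ordinal h2); rewrite mxE.
exists b; split.
- apply/andP; split.
    by apply/is_trig_mxP => i j hij; rewrite mxE f0.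
  rewrite unitmxE unitfE.
  have <- : GZminor 0 n b = \det b.
    rewrite GZminorE // subnn; congr (\det _); apply/matrixP => i j.
    by rewrite mxE !add0n entryE.
  by rewrite hb.
- by move=> i j hij; rewrite hb.
- move=> v; have := svalP v; have := ltn_ord (sval v).1 => h1 h2.
  rewrite /GZlambda !hb; try lia.
  rewrite /D big_ord_recr /= mulrAC divff ?mul1r; last by apply/prodf_neq0.
  by rewrite subKn.
Qed.

End GZInverse.

(** * Tropical asymptotics *)

Section SubtractionFree.
Variables (R : realType) (V : Type).
Implicit Types (e : sfexpr R V) (x : V -> R).

(** Evaluation in R itself, where the order is total and [expR] is available. *)
Fixpoint sfreal x e : R :=
  match e with
  | SFvar v => x v
  | SFconst c _ => c
  | SFadd e1 e2 => sfreal x e1 + sfreal x e2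
  | SFmul e1 e2 => sfreal x e1 * sfreal x e2
  | SFdiv e1 e2 => sfreal x e1 / sfreal x e2
  end.

Lemma sfreal_gt0 x e : (forall v, 0 < x v) -> 0 < sfreal x e.
Proof.
move=> hx; elim: e => //= e1 h1 e2 h2; first exact: addr_gt0.
  exact: mulr_gt0.
exact: divr_gt0.
Qed.

Lemma sfeval_real x e : sfeval (fun v => real_complex R (x v)) e = real_complex R (sfreal x e).
Proof.
by elim: e => //= e1 -> e2 ->; rewrite ?rmorphD ?rmorphM //= fmorphV.
Qed.

Lemma sfdefined_real x e : (forall v, 0 < x v) ->
  sfdefined (fun v => real_complex R (x v)) e.
Proof.
move=> hx; elim: e => //= e1 -> e2 -> //=.
by rewrite sfeval_real fmorph_eq0 gt_eqF // sfreal_gt0.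
Qed.

(** The larger exponential E2 plays the role of the maximum: it bounds both summands from above, and
    v2 alone bounds it from below. *)
Lemma sandwich_add (C1 C2 v1 v2 E1 E2 : R) : 0 < C1 -> 0 < C2 -> 0 < v1 -> 0 < v2 ->
  E1 <= E2 -> v1 <= C1 * E1 -> v2 <= C2 * E2 -> E2 <= C2 * v2 ->
  v1 + v2 <= (C1 + C2) * E2 /\ E2 <= (C1 + C2) * (v1 + v2).
Proof.
move=> p1 p2 g1 g2 hE a1 a2 b2; have := ler_wpM2l (ltW p1) hE.
have := mulr_gt0 p1 g1; have := mulr_gt0 p1 g2; have := mulr_gt0 p2 g1.
by rewrite !mulrDl !mulrDr; split; lra.
Qed.

Lemma sandwich_mul (C1 C2 v1 v2 E1 E2 : R) : 0 < C1 -> 0 < C2 -> 0 < v1 -> 0 < v2 ->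
  0 < E1 -> 0 < E2 -> v1 <= C1 * E1 -> v2 <= C2 * E2 -> E1 <= C1 * v1 -> E2 <= C2 * v2 ->
  v1 * v2 <= C1 * C2 * (E1 * E2) /\ E1 * E2 <= C1 * C2 * (v1 * v2).
Proof.
move=> p1 p2 g1 g2 e1 e2 a1 a2 b1 b2; rewrite (mulrACA C1 C2 E1) (mulrACA C1 C2 v1).
by split; apply: ler_pM => //; apply: ltW.
Qed.

Lemma sandwich_div (C1 C2 v1 v2 E1 E2 : R) : 0 < C1 -> 0 < C2 -> 0 < v1 -> 0 < v2 ->
  0 < E1 -> 0 < E2 -> v1 <= C1 * E1 -> v2 <= C2 * E2 -> E1 <= C1 * v1 -> E2 <= C2 * v2 ->
  v1 / v2 <= C1 * C2 * (E1 / E2) /\ E1 / E2 <= C1 * C2 * (v1 / v2).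
Proof.
move=> p1 p2 g1 g2 e1 e2 a1 a2 b1 b2; apply: sandwich_mul; rewrite ?invr_gt0 //.
  by rewrite ler_pdivlMr // mulrC ler_pdivrMr // mulrC.
by rewrite ler_pdivlMr // mulrC ler_pdivrMr // mulrC.
Qed.

(** The point of the statement is that C is uniform in s; it is built by induction on [e] from the
    constants of the subexpressions. *)
Lemma sftrop_sandwich (xt : V -> R) e : exists2 C : R, 0 < C &
  forall s, 0 <= s -> let E := expR (s * sftrop xt e) in
    let v := sfreal (fun v => expR (s * xt v)) e in v <= C * E /\ E <= C * v.
Proof.
have gt0 s e' : 0 < sfreal (fun v => expR (s * xt v)) e'.
  by apply: sfreal_gt0 => v; exact: expR_gt0.
elim: e => [v|c c0|e1 [C1 p1 h1] e2 [C2 p2 h2]|e1 [C1 p1 h1] e2 [C2 p2 h2]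
           |e1 [C1 p1 h1] e2 [C2 p2 h2]] /=.
- by exists 1 => // s _; rewrite mul1r.
(* A constant has tropical value 0, so E = 1, and both c and its inverse must be bounded. *)
- exists (c + c^-1) => [|s _]; first by rewrite addr_gt0 ?invr_gt0.
  rewrite mulr0 expR0 mulr1 mulrDl mulVf ?gt_eqF //.
  by split; rewrite ?lerDl ?lerDr ?mulr_ge0 ?invr_ge0 // ltW.
- exists (C1 + C2) => [|s s0]; first exact: addr_gt0.
  have [a1 b1] := h1 s s0; have [a2 b2] := h2 s s0.
  have g1 := gt0 s e1; have g2 := gt0 s e2.
  case: (leP (sftrop xt e1) (sftrop xt e2)) => [|/ltW] /(ler_wpM2l s0) hE;
    rewrite -ler_expR in hE.
    exact: (sandwich_add p1 p2 g1 g2 hE a1 a2 b2).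
  by rewrite [C1 + _]addrC [sfreal _ e1 + _]addrC;
    exact: (sandwich_add p2 p1 g2 g1 hE a2 a1 b1).
- exists (C1 * C2) => [|s s0]; first exact: mulr_gt0.
  have [a1 b1] := h1 s s0; have [a2 b2] := h2 s s0; rewrite mulrDr expRD.
  exact: (sandwich_mul p1 p2 (gt0 s e1) (gt0 s e2) (expR_gt0 _) (expR_gt0 _) a1 a2 b1 b2).
- exists (C1 * C2) => [|s s0]; first exact: mulr_gt0.
  have [a1 b1] := h1 s s0; have [a2 b2] := h2 s s0; rewrite mulrBr expRD expRN.
  exact: (sandwich_div p1 p2 (gt0 s e1) (gt0 s e2) (expR_gt0 _) (expR_gt0 _) a1 a2 b1 b2).
Qed.

End SubtractionFree.

(** * The potential as a sum of slope differences *)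

Section Ends.
Variables (F : fieldType) (n : nat).
Implicit Types A B C E : nat -> 'rV[F]_n.

Lemma slope_B A B C E m k : slope A B C E m k 0 0 =
  wedge (mkseq A m ++ A m.+1 :: mkseq B k) / wedge (mkseq A m.+1 ++ mkseq B k).
Proof. by rewrite /slope /mixed /= !cats0. Qed.

Lemma slope_E A B C E m k : slope A B C E m 0 0 k =
  wedge (mkseq A m ++ A m.+1 :: mkseq E k) / wedge (mkseq A m.+1 ++ mkseq E k).
Proof. by []. Qed.

(** Numerator and denominator rotate with the same twist. The result has the earlier flag in front,
    the form required by [wedge_BK_second]. *)
Lemma slope_twist A E m k : (m + k).+1 = n ->
  wedge (mkseq A m ++ A m.+1 :: mkseq (twist E) k)
    / wedge (mkseq A m.+1 ++ mkseq (twist E) k) =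
  wedge (mkseq E k ++ mkseq A m ++ [:: A m.+1]) / wedge (mkseq E k ++ mkseq A m.+1).
Proof.
move=> h.
rewrite [wedge (mkseq E k ++ mkseq A m ++ _)]wedge_twist; last first.
  by rewrite size_cat size_mkseq /=; lia.
rewrite [wedge (mkseq E k ++ mkseq A m.+1)]wedge_twist; last by rewrite size_mkseq; lia.
by rewrite -catA.
Qed.

End Ends.

Section Potential.
Variables (F : numFieldType) (n : nat) (g : triple F n).
Local Notation f0 := (flag0 g).
Local Notation f1 := (flag1 g).
Local Notation f2 := (flag2 g).
Local Notation f3 := (flag3 g).
Local Notation N := (mixed f0 f1 f2 f3).
Hypothesis ug : forall k, g k \in unitmx.
Hypothesis pos : posflags f0 f1 f2 f3.

Let u1 : g_ g 1 \in unitmx. Proof. exact: ug. Qed.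
Let u12 : g_ g 1 *m g_ g 2 \in unitmx.
Proof. by rewrite unitmx_mul !ug. Qed.

Let spread0 m := spread f0 f1 f2 f3 m.
Let spread1 m := spread f1 f2 f3 (twist f0) m.
Let spread2 m := spread f2 f3 (twist f0) (twist f1) m.
Let spread3 m := spread f3 (twist f0) (twist f1) (twist f2) m.

Let f1E : f1 = vcol (1%:M *m g_ g 1). Proof. by rewrite mul1mx. Qed.
Let f3E : f3 = vcol (1%:M *m (g_ g 1 *m g_ g 2 *m g_ g 3)). Proof. by rewrite mul1mx. Qed.

(** For each flag the two extremal slopes involve only its cyclic neighbours: the later matrix flag
    gives a [BK_first] term, the earlier one a [BK_second] term. The pair of flags 0 and 3 gives the
    terms of the full product, with a minus sign. *)
Lemma spread0E m : (m.+1 < n)%N -> spread0 m =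
  BK_first (n - m.+1) (g_ g 1) - BK_first (n - m.+1) (g_ g 1 *m g_ g 2 *m g_ g 3).
Proof.
move=> hm; rewrite /spread0 /spread slope_B slope_E.
rewrite {1 2}f3E f1E !wedge_BK_first ?unitmx1 //.
by rewrite opprK addrC.
Qed.

Lemma spread1E m : (m.+1 < n)%N -> spread1 m =
  BK_second m.+1 (g_ g 1) + BK_first (n - m.+1) (g_ g 2).
Proof.
move=> hm; rewrite /spread1 /spread slope_B slope_E slope_twist; last by lia.
by rewrite wedge_BK_first // opprK f1E wedge_BK_second ?unitmx1.
Qed.

Lemma spread2E m : (m.+1 < n)%N -> spread2 m =
  BK_second m.+1 (g_ g 2) + BK_first (n - m.+1) (g_ g 3).
Proof.
move=> hm; rewrite /spread2 /spread slope_B slope_E slope_twist; last by lia.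
by rewrite wedge_BK_first // opprK wedge_BK_second.
Qed.

Lemma spread3E m : (m.+1 < n)%N -> spread3 m =
  BK_second m.+1 (g_ g 3) - BK_second m.+1 (g_ g 1 *m g_ g 2 *m g_ g 3).
Proof.
move=> hm; rewrite /spread3 /spread slope_B slope_E !slope_twist; try lia.
by rewrite wedge_BK_second // f3E wedge_BK_second ?unitmx1.
Qed.

Lemma Phi3_spread : Phi3 g = \sum_(0 <= m < n.-1)
  (spread0 m + spread1 m + spread2 m + spread3 m).
Proof.
have sum1 (h : 'M[F]_n) : Phi_BK h = \sum_(0 <= m < n.-1) BK_first (n - m.+1) h
    + \sum_(0 <= m < n.-1) BK_second m.+1 h.
  rewrite Phi_BKE big_add1 big_split /=.
  congr (_ + _).
  (* [BK_first] occurs at n - m - 1 in the spreads, so its sum is reversed. *)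
  rewrite big_nat_rev /=.
  by apply: eq_big_nat => i hi; congr (BK_first _ _); lia.
rewrite /Phi3 !sum1.
have -> : \sum_(0 <= m < n.-1) (spread0 m + spread1 m + spread2 m + spread3 m) =
  \sum_(0 <= m < n.-1) (
    (BK_first (n - m.+1) (g_ g 1) + BK_second m.+1 (g_ g 1))
  + (BK_first (n - m.+1) (g_ g 2) + BK_second m.+1 (g_ g 2))
  + (BK_first (n - m.+1) (g_ g 3) + BK_second m.+1 (g_ g 3))
  - (BK_first (n - m.+1) (g_ g 1 *m g_ g 2 *m g_ g 3)
    + BK_second m.+1 (g_ g 1 *m g_ g 2 *m g_ g 3))).
  apply: eq_big_nat => m hm.
  rewrite spread0E ?spread1E ?spread2E ?spread3E; try lia.
  ring.
by rewrite sumrB !big_split.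
Qed.

Let pos1 : posflags f1 f2 f3 (twist f0). Proof. exact: posflags_rot. Qed.
Let pos2 : posflags f2 f3 (twist f0) (twist f1). Proof. exact: posflags_rot. Qed.
Let pos3 : posflags f3 (twist f0) (twist f1) (twist f2).
Proof. exact: posflags_rot. Qed.

Lemma spread_le_Phi3 m : (m.+1 < n)%N ->
  [/\ spread0 m <= Phi3 g, spread1 m <= Phi3 g, spread2 m <= Phi3 g & spread3 m <= Phi3 g].
Proof.
move=> hm.
have s0 k : (k.+1 < n)%N -> 0 <= spread0 k by move=> /ltnW; apply: spread_ge0.
have s1 k : (k.+1 < n)%N -> 0 <= spread1 k by move=> /ltnW; apply: spread_ge0.
have s2 k : (k.+1 < n)%N -> 0 <= spread2 k by move=> /ltnW; apply: spread_ge0.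
have s3 k : (k.+1 < n)%N -> 0 <= spread3 k by move=> /ltnW; apply: spread_ge0.
have hle : spread0 m + spread1 m + spread2 m + spread3 m <= Phi3 g.
  rewrite Phi3_spread big_mkord.
  have hm' : (m < n.-1)%N by lia.
  rewrite (bigD1 (Ordinal hm')) //= lerDl; apply: sumr_ge0 => i _.
  have hi : (i.+1 < n)%N by have := ltn_ord i; lia.
  exact: addr_ge0 (addr_ge0 (addr_ge0 (s0 _ hi) (s1 _ hi)) (s2 _ hi)) (s3 _ hi).
move: (s0 m hm) (s1 m hm) (s2 m hm) (s3 m hm) hle.
move: (spread0 m) (spread1 m) (spread2 m) (spread3 m) => a b c d a0 b0 c0 d0 hle.
split; apply: le_trans hle.
- by rewrite -!addrA lerDl !addr_ge0.
- by rewrite [a + b]addrC -!addrA lerDl !addr_ge0.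
- by rewrite addrAC lerDr !addr_ge0.
- by rewrite lerDr !addr_ge0.
Qed.

Let N1E p q r s : (p + q + r + s = n)%N ->
  mixed f1 f2 f3 (twist f0) p q r s = N s p q r.
Proof. by move=> h; rewrite -mixed_rot //; lia. Qed.

Let N2E p q r s : (p + q + r + s = n)%N ->
  mixed f2 f3 (twist f0) (twist f1) p q r s = N r s p q.
Proof. by move=> h; rewrite -mixed_rot ?N1E //; lia. Qed.

Let N3E p q r s : (p + q + r + s = n)%N ->
  mixed f3 (twist f0) (twist f1) (twist f2) p q r s = N q r s p.
Proof. by move=> h; rewrite -mixed_rot ?N2E //; lia. Qed.

Let rhombi (A B C E : nat -> 'rV[F]_n) (T : F) (pE : posflags A B C E) m q r s :
  (m + q + r + s + 2 = n)%N ->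
  spread A B C E m <= T ->
  [/\ mixed A B C E m.+2 q r s * mixed A B C E m q.+1 r.+1 s <=
        T * (mixed A B C E m.+1 q.+1 r s * mixed A B C E m.+1 q r.+1 s),
      mixed A B C E m.+2 q r s * mixed A B C E m q.+1 r s.+1 <=
        T * (mixed A B C E m.+1 q.+1 r s * mixed A B C E m.+1 q r s.+1) &
      mixed A B C E m.+2 q r s * mixed A B C E m q r.+1 s.+1 <=
        T * (mixed A B C E m.+1 q r.+1 s * mixed A B C E m.+1 q r s.+1)].
Proof.
move=> hn hT; have [h1 h2 h3] := rhombus_le_spread pE hn.
split; rewrite -ler_pdivrMr; try (by apply: le_trans hT);
  by apply: mulr_gt0; apply: pE; lia.
Qed.

Let rhombi0 y0 y1 y2 y3 : (y0 + y1 + y2 + y3 + 2 = n)%N ->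
  [/\ N y0.+2 y1 y2 y3 * N y0 y1.+1 y2.+1 y3 <=
        Phi3 g * (N y0.+1 y1.+1 y2 y3 * N y0.+1 y1 y2.+1 y3),
      N y0.+2 y1 y2 y3 * N y0 y1.+1 y2 y3.+1 <=
        Phi3 g * (N y0.+1 y1.+1 y2 y3 * N y0.+1 y1 y2 y3.+1) &
      N y0.+2 y1 y2 y3 * N y0 y1 y2.+1 y3.+1 <=
        Phi3 g * (N y0.+1 y1 y2.+1 y3 * N y0.+1 y1 y2 y3.+1)].
Proof.
move=> h; have hm : (y0.+1 < n)%N by lia.
by have [h0 _ _ _] := spread_le_Phi3 hm; apply: rhombi.
Qed.

Let rhombi1 y0 y1 y2 y3 : (y0 + y1 + y2 + y3 + 2 = n)%N ->
  [/\ N y0 y1.+2 y2 y3 * N y0 y1 y2.+1 y3.+1 <=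
        Phi3 g * (N y0 y1.+1 y2.+1 y3 * N y0 y1.+1 y2 y3.+1),
      N y0 y1.+2 y2 y3 * N y0.+1 y1 y2.+1 y3 <=
        Phi3 g * (N y0 y1.+1 y2.+1 y3 * N y0.+1 y1.+1 y2 y3) &
      N y0 y1.+2 y2 y3 * N y0.+1 y1 y2 y3.+1 <=
        Phi3 g * (N y0 y1.+1 y2 y3.+1 * N y0.+1 y1.+1 y2 y3)].
Proof.
move=> h; have hm : (y1.+1 < n)%N by lia.
have [_ h0 _ _] := spread_le_Phi3 hm; have hn : (y1 + y2 + y3 + y0 + 2 = n)%N by lia.
by have := rhombi pos1 hn h0; clear h0; rewrite !N1E //; lia.
Qed.

Let rhombi2 y0 y1 y2 y3 : (y0 + y1 + y2 + y3 + 2 = n)%N ->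
  [/\ N y0 y1 y2.+2 y3 * N y0.+1 y1 y2 y3.+1 <=
        Phi3 g * (N y0 y1 y2.+1 y3.+1 * N y0.+1 y1 y2.+1 y3),
      N y0 y1 y2.+2 y3 * N y0 y1.+1 y2 y3.+1 <=
        Phi3 g * (N y0 y1 y2.+1 y3.+1 * N y0 y1.+1 y2.+1 y3) &
      N y0 y1 y2.+2 y3 * N y0.+1 y1.+1 y2 y3 <=
        Phi3 g * (N y0.+1 y1 y2.+1 y3 * N y0 y1.+1 y2.+1 y3)].
Proof.
move=> h; have hm : (y2.+1 < n)%N by lia.
have [_ _ h0 _] := spread_le_Phi3 hm; have hn : (y2 + y3 + y0 + y1 + 2 = n)%N by lia.
by have := rhombi pos2 hn h0; clear h0; rewrite !N2E //; lia.
Qed.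

Let rhombi3 y0 y1 y2 y3 : (y0 + y1 + y2 + y3 + 2 = n)%N ->
  [/\ N y0 y1 y2 y3.+2 * N y0.+1 y1.+1 y2 y3 <=
        Phi3 g * (N y0.+1 y1 y2 y3.+1 * N y0 y1.+1 y2 y3.+1),
      N y0 y1 y2 y3.+2 * N y0.+1 y1 y2.+1 y3 <=
        Phi3 g * (N y0.+1 y1 y2 y3.+1 * N y0 y1 y2.+1 y3.+1) &
      N y0 y1 y2 y3.+2 * N y0 y1.+1 y2.+1 y3 <=
        Phi3 g * (N y0 y1.+1 y2 y3.+1 * N y0 y1 y2.+1 y3.+1)].
Proof.
move=> h; have hm : (y3.+1 < n)%N by lia.
have [_ _ _ h0] := spread_le_Phi3 hm; have hn : (y3 + y0 + y1 + y2 + 2 = n)%N by lia.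
by have := rhombi pos3 hn h0; clear h0; rewrite !N3E //; lia.
Qed.

Lemma rhombus_le_Phi3 y0 y1 y2 y3 a b c :
  (y0 + y1 + y2 + y3 + 2 = n)%N -> uniq [:: a; b; c] -> all (fun i => i < 4)%N [:: a; b; c] ->
  let M (d : nat -> nat) := N (y0 + d 0) (y1 + d 1) (y2 + d 2) (y3 + d 3) in
  M (fun i => 2 * (i == a))%N * M (fun i => (i == b) + (i == c))%N <=
  Phi3 g * (M (fun i => (i == a) + (i == b))%N * M (fun i => (i == a) + (i == c))%N).
Proof.
move=> hy.
have [a0 b0 c0] := rhombi0 hy; have [a1 b1 c1] := rhombi1 hy.
have [a2 b2 c2] := rhombi2 hy; have [a3 b3 c3] := rhombi3 hy.
(* Up to exchanging b and c, the surviving cases are the twelve inequalities above; the exchange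
   only swaps the two factors of the short diagonal. *)
move: a b c => [|[|[|[|?]]]] [|[|[|[|?]]]] [|[|[|[|?]]]] //= _ _;
  rewrite ?muln0 ?muln1 ?addn0 ?add0n ?addn1 ?addn2 //.
all: by rewrite [X in _ <= _ * X]mulrC.
Qed.

End Potential.

Section Regularity.
Variables (F : numFieldType) (n : nat) (g : triple F n).
Hypothesis ug : forall k, g k \in unitmx.
Hypothesis pos : posflags (flag0 g) (flag1 g) (flag2 g) (flag3 g).

(** Each denominator of the potential is, up to an invertible determinant, a mixed determinant of
    two flags. Hence the expression for [Phi3] may be evaluated at positive points. *)
Lemma posflags_regular : Phi3_regular g.
Proof.
have nz (h g' : 'M[F]_n) t i p q r s : (p + q + r + s = n)%N -> (t + i = n)%N ->
    mixed (flag0 g) (flag1 g) (flag2 g) (flag3 g) p q r s =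
    wedge (mkseq (vcol h) t ++ mkseq (vcol (h *m g')) i) -> BK_den i g' != 0.
  move=> hn hi e; have := pos hn; rewrite e wedge_BK_den // => /lt0r_neq0.
  by rewrite mulf_eq0 negb_or => /andP[].
split=> i hi.
- apply: (nz 1%:M _ (n - i)%N i (n - i)%N i 0%N 0%N); try lia.
  by rewrite mul1mx /mixed /= !cats0.
- apply: (nz (g_ g 1) _ (n - i)%N i 0%N (n - i)%N i 0%N); try lia.
  by rewrite /mixed /= !cats0.
- apply: (nz (g_ g 1 *m g_ g 2) _ (n - i)%N i 0%N 0%N (n - i)%N i); try lia.
  by rewrite /mixed /=.
- apply: (nz 1%:M _ (n - i)%N i (n - i)%N 0%N 0%N i); try lia.
  by rewrite mul1mx /mixed /=.
Qed.

End Regularity.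

(** * Small rhombi of multi-corner minors *)

Lemma sum_ord4 (x : 'I_4 -> nat) :
  (\sum_i x i = x (inord 0) + x (inord 1) + x (inord 2) + x (inord 3))%N.
Proof.
rewrite (eq_bigr (fun i : 'I_4 => x (inord i))) => [|i _]; last by rewrite inord_val.
by rewrite !big_ord_recr big_ord0.
Qed.

Lemma sum_rhombus n (y : 'I_4 -> nat) (a b c : 'I_4) : (\sum_i y i + 2 = n)%N ->
  [/\ \sum_i (y i + 2 * (i == a)) = n, \sum_i (y i + (i == b) + (i == c)) = n,
      \sum_i (y i + (i == a) + (i == b)) = n &
      \sum_i (y i + (i == a) + (i == c)) = n]%N.
Proof.
move=> hy; have h1 (d : 'I_4) : (\sum_(i < 4) (i == d) = 1)%N.
  by rewrite (bigD1 d) //= eqxx big1 ?addn0 // => i /negbTE ->.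
by split; rewrite !big_split /= !h1 ?big1_eq -?addnA.
Qed.

Lemma forget0_Delta3 n (x : 'I_4 -> nat) : (\sum_i x i = n)%N -> Delta3 n (forget0 x).
Proof. by rewrite sum_ord4 /Delta3 /=; lia. Qed.

Lemma small_rhombus_Delta3 n a1 a3 a2 a4 : small_rhombus n a1 a3 a2 a4 ->
  [/\ Delta3 n a1, Delta3 n a3, Delta3 n a2 & Delta3 n a4].
Proof.
case=> y [a [b [c [_ /(sum_rhombus a b c)[s1 s3 s2 s4] [-> -> -> ->]]]]].
by split; apply: forget0_Delta3.
Qed.

Section Rhombus.
Variables (F : numFieldType) (n : nat) (g : triple F n).
Hypothesis pos : forall i j k, (i + j + k <= n)%N -> 0 < multicorner i j k g.

Lemma multicorner_posflags : posflags (flag0 g) (flag1 g) (flag2 g) (flag3 g).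
Proof.
move=> p q r s hn; have := pos (i := q) (j := r) (k := s) ltac:(lia).
by rewrite multicornerE; last lia; have -> : (n - q - r - s = p)%N by lia.
Qed.

Lemma multicorner_rhombus_le a1 a3 a2 a4 :
  (forall k, g k \in unitmx) -> small_rhombus n a1 a3 a2 a4 ->
  let M (a : nat * nat * nat) := multicorner a.1.1 a.1.2 a.2 g in
  M a1 * M a3 <= Phi3 g * (M a2 * M a4).
Proof.
move=> ug [y [a [b [c [u hy [-> -> -> ->]]]]]].
have mc (x : 'I_4 -> nat) : (\sum_i x i = n)%N ->
    multicorner (forget0 x).1.1 (forget0 x).1.2 (forget0 x).2 g =
    mixed (flag0 g) (flag1 g) (flag2 g) (flag3 g)
      (x (inord 0)) (x (inord 1)) (x (inord 2)) (x (inord 3)).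
  move=> hx; rewrite multicornerE; last exact: forget0_Delta3.
  by rewrite sum_ord4 in hx; congr mixed; rewrite /=; lia.
have [s1 s3 s2 s4] := sum_rhombus a b c hy.
have hu : uniq [:: a : nat; b : nat; c : nat] by rewrite -(map_inj_uniq val_inj) in u.
have hy' := hy; rewrite sum_ord4 in hy'.
have := rhombus_le_Phi3 ug multicorner_posflags hy' hu.
rewrite /= !ltn_ord => /(_ isT).
have E (k : nat) (d : 'I_4) : (k < 4)%N -> (inord k == d) = (k == d)%N.
  by move=> hk; rewrite -val_eqE /= inordK.
by move: (mc _ s1) (mc _ s3) (mc _ s2) (mc _ s4); rewrite /= !E // !addnA => -> -> -> ->.
Qed.

End Rhombus.

Theorem theorem4p23 (R : realType) (n : nat)
    (Phi3t : tropical_point R n -> R)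
    (Mt : nat * nat * nat -> tropical_point R n -> R)
    (hPhi3 : is_tropicalization (@Phi3_regular R[i] n) (@Phi3 R[i] n) Phi3t)
    (hM : forall alpha : nat * nat * nat, Delta3 n alpha ->
       is_tropicalization (fun _ => True)
         (@multicorner R[i] n alpha.1.1 alpha.1.2 alpha.2) (Mt alpha))
    (xt : tropical_point R n) (hxt : Phi3t xt <= 0)
    (a1 a3 a2 a4 : nat * nat * nat) (hrh : small_rhombus n a1 a3 a2 a4) :
  Mt a1 xt + Mt a3 xt <= Mt a2 xt + Mt a4 xt.
Proof.
have [D1 D3 D2 D4] := small_rhombus_Delta3 hrh.
have [eP [rP tP]] := hPhi3; rewrite tP in hxt.
have [e1 [r1 t1]] := hM a1 D1; have [e2 [r2 t2]] := hM a2 D2.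
have [e3 [r3 t3]] := hM a3 D3; have [e4 [r4 t4]] := hM a4 D4.
rewrite t1 t2 t3 t4.
have [CP pP hP] := sftrop_sandwich xt eP.
have [C1 p1 h1] := sftrop_sandwich xt e1.
have [C2 p2 h2] := sftrop_sandwich xt e2.
have [C3 p3 h3] := sftrop_sandwich xt e3.
have [C4 p4 h4] := sftrop_sandwich xt e4.
(* The algebraic inequality at the point of the chart with coordinates exp (s * xt), rewritten
   through the given expressions. *)
have key s : let v := sfreal (fun v => expR (s * xt v)) in
    v e1 * v e3 <= v eP * (v e2 * v e4).
  pose x v := real_complex R (expR (s * xt v)).
  have x0 v : x v != 0 by rewrite fmorph_eq0 gt_eqF // expR_gt0.
  have [g hg] := fin_all_exists (fun k : 'I_3 => GZchart_surj (fun v => x0 (k, v))).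
  have gB k : Bminus (g k) by have [] := hg k.
  have gD k : GZdomain (g k) by have [] := hg k.
  have cg : coords g = x by apply: funext => -[k v]; have [_ _] := hg k; apply.
  have sfd e : sfdefined (coords g) e.
    by rewrite cg; apply: sfdefined_real => v; apply: expR_gt0.
  have sfe e : sfeval (coords g) e = real_complex R (sfreal (fun v => expR (s * xt v)) e).
    by rewrite cg sfeval_real.
  have sf0 e : 0 < sfreal (fun v => expR (s * xt v)) e.
    by apply: sfreal_gt0 => v; apply: expR_gt0.
  have ug k : g k \in unitmx by have /andP[] := gB k.
  have pos i j k : (i + j + k <= n)%N -> 0 < multicorner i j k g.
    (* Positivity of the minor follows from its own subtraction-free expression. *)
    move=> hn; have [e [re _]] := hM (i, j, k) hn.
    by rewrite (re g gB gD I (sfd e)) sfe ltcR.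
  have := multicorner_rhombus_le pos ug hrh.
  rewrite /= (r1 g gB gD I (sfd e1)) (r2 g gB gD I (sfd e2)) (r3 g gB gD I (sfd e3)).
  rewrite (r4 g gB gD I (sfd e4)) (rP g gB gD _ (sfd eP)); last first.
    exact: posflags_regular (multicorner_posflags pos).
  by rewrite !sfe -!rmorphM lecR.
rewrite leNgt; apply/negP => hlt.
set T1 := sftrop xt e1 in h1 hlt; set T2 := sftrop xt e2 in h2 hlt.
set T3 := sftrop xt e3 in h3 hlt; set T4 := sftrop xt e4 in h4 hlt.
pose d := T1 + T3 - (T2 + T4).
have d0 : 0 < d by rewrite subr_gt0.
(* [K] collects the constants of all five sandwiches, and s * d = K. A violation by d would then
   force exp K <= K. *)
pose K := C1 * C3 * (CP * (C2 * C4)).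
have K0 : 0 < K by rewrite !mulr_gt0.
pose s := K / d.
have s0 : 0 <= s by rewrite divr_ge0 // ltW.
have E1 := expR_gt0 (s * T1); have E2 := expR_gt0 (s * T2).
have E3 := expR_gt0 (s * T3); have E4 := expR_gt0 (s * T4).
have [_ b1] := h1 s s0; have [b2 _] := h2 s s0.
have [_ b3] := h3 s s0; have [b4 _] := h4 s s0.
have {hP}[bP _] := hP s s0.
have v0 e : 0 <= sfreal (fun v => expR (s * xt v)) e.
  by rewrite ltW // sfreal_gt0 // => v; apply: expR_gt0.
(* This is where the tropical hypothesis enters: the potential stays bounded for all s >= 0. *)
have {}bP : sfreal (fun v => expR (s * xt v)) eP <= CP.
  apply: le_trans bP _; rewrite ger_pMr // -expR0 ler_expR.
  exact: mulr_ge0_le0.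
have {key}key := key s.
have up : expR (s * T1) * expR (s * T3) <= K * (expR (s * T2) * expR (s * T4)).
  apply: le_trans (ler_pM (ltW E1) (ltW E3) b1 b3) _.
  rewrite mulrACA /K -[leRHS]mulrA; apply: ler_wpM2l; first exact/ltW/mulr_gt0.
  apply: le_trans key _; rewrite -[leRHS]mulrA; apply: ler_pM; rewrite ?mulr_ge0 //.
  by rewrite mulrACA; apply: ler_pM.
have : expR K <= K.
  rewrite -(ler_pM2r (mulr_gt0 E2 E4)); apply: le_trans up.
  rewrite -!expRD ler_expR -!mulrDr -lerBrDr -mulrBr -/d.
  by rewrite /s divfK ?gt_eqF.
by rewrite leNgt => /negP[]; apply: lt_le_trans (expR_ge1Dx K); rewrite ltrDr.
Qed.
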